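(* For bipartite graphs $H=(U\dot\cup V,E)$ in which every node of $U$ has degree at least $c\ln^2 n$ (for a large enough constant $c$), the $\lambda$-local splitting problem, for any $\lambda = 1/\operatorname{poly}\log n$, is $\mathsf{P}\text{-}\mathsf{SLOCAL}$-complete.
   Context: Distributed graph problems: the input graph (here $H$, with $n$ nodes) is also the communication network; nodes have unique identifiers (of $O(\log n)$ bits) and possibly local inputs, and each node must produce a local output; the problem specifies which collections of outputs are valid. LOCAL model: computation proceeds in synchronous rounds; in each round every node performs arbitrary local computation, sends a message of arbitrary size to each neighbor and receives its neighbors' messages. $\mathsf{LOCAL}(t)$ is the class of problems solvable deterministically in $t$ rounds. SLOCAL model: the nodes are processed sequentially in an arbitrary order. When a node $v$ is processed, it can read the current state of all nodes in its $r$-hop neighborhood (their initial inputs and everything stored by previously processed nodes), and computes its output as an arbitrary function of this; it may additionally store an arbitrary amount of information in its own state, readable by later processed nodes. $r$ is the locality. $\mathsf{SLOCAL}(t)$ is the class of problems solvable deterministically with locality $t$ (correct for every processing order). $\mathsf{P}\text{-}\mathsf{LOCAL} := \mathsf{LOCAL}(\log^{O(1)} n)$, $\mathsf{P}\text{-}\mathsf{SLOCAL} := \mathsf{SLOCAL}(\log^{O(1)} n)$. $\mathcal{P}_1$ is polylog-reducible to $\mathcal{P}_2$ if a deterministic polylog-round LOCAL algorithm for $\mathcal{P}_2$ implies one for $\mathcal{P}_1$. $\mathcal{P}$ is $\mathsf{P}\text{-}\mathsf{SLOCAL}$-complete if $\mathcal{P}\in\mathsf{P}\text{-}\mathsf{SLOCAL}$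 and every problem in $\mathsf{P}\text{-}\mathsf{SLOCAL}$ is polylog-reducible to $\mathcal{P}$. Local splitting: given a bipartite graph $B=(U\dot\cup V,E_B)$ with $E_B\subseteq U\times V$ and $\lambda\in[0,1/2]$, a $\lambda$-local splitting of $B$ is a 2-coloring of the nodes of $V$ with colors red and blue such that each node $u\in U$ has at least $\lfloor\lambda\cdot d(u)\rfloor$ neighbors of each color, where $d(u)$ is the degree of $u$. *)

(* Defs.v *)
From HB Require Import structures.
From mathcomp Require Import all_boot all_order all_algebra.
From mathcomp Require Import reals exp.

Set Implicit Arguments.
Unset Strict Implicit.
Unset Printing Implicit Defensive.

Import Order.TTheory GRing.Theory Num.Theory.

Record sgraph := SGraph {
  node :> finType;
  adj : rel node;
  adj_sym : symmetric adj;
  adj_irrefl : irreflexive adj }.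

Definition deg (G : sgraph) (v : G) : nat := #|[set u | adj v u]|.

(* The nodes at distance at most r from v. *)
Definition hop_ball (G : sgraph) (r : nat) (v : G) : {set G} :=
  iter r (fun B => B :|: [set u | [exists w in B, adj w u]]) [set v].

(* [admissible] is the promise on the instances (graph and local inputs);
   outputs are only required to be valid on admissible instances. *)
Record problem := Problem {
  input : Type;
  output : Type;
  admissible : forall G : sgraph, (G -> input) -> Prop;
  valid : forall G : sgraph, (G -> input) -> (G -> output) -> Prop }.

(* Unique identifiers of k * log n bits. *)
Definition identifiers (k : nat) (G : sgraph) (id : G -> nat) : Prop :=
  injective id /\ forall v, id v < #|G| ^ k.

(* t(n) = log^{O(1)} n, an asymptotic bound: small n are unconstrained. *)
Definition polylog (t : nat -> nat) : Prop :=
  exists C N : nat, forall n, N <= n -> t n <= trunc_log 2 n ^ C.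

(* A node starts from the number n of nodes, its identifier and its input.
   [lsend s i] is the message for the neighbor with identifier i, and in the
   inbox given to [lstep], [i |-> Some m] means that the neighbor with
   identifier i sent m, [i |-> None] that no neighbor has identifier i. *)
Record local_algorithm (I O : Type) := LocalAlgorithm {
  lstate : Type;
  lmsg : Type;
  linit : nat -> nat -> I -> lstate;
  lsend : lstate -> nat -> lmsg;
  lstep : lstate -> (nat -> option lmsg) -> lstate;
  lout : lstate -> O }.

Section LocalRun.
Variables (I O : Type) (A : local_algorithm I O).
Variables (G : sgraph) (id : G -> nat) (x : G -> I).

Definition inbox (s : G -> lstate A) (v : G) (i : nat) : option (lmsg A) :=
  omap (fun u => lsend (s u) (id v)) [pick u | adj v u & id u == i].

Fixpoint local_run (r : nat) : G -> lstate A :=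
  if r is r'.+1 then fun v => lstep (local_run r' v) (inbox (local_run r') v)
  else fun v => linit A #|G| (id v) (x v).
End LocalRun.

Definition LOCAL (k : nat) (t : nat -> nat) (P : problem) : Prop :=
  exists A : local_algorithm (input P) (output P),
  forall (G : sgraph) (x : G -> input P) (id : G -> nat),
    admissible x -> identifiers k id ->
    valid x (fun v => lout (local_run A id x (t #|G|) v)).

(* What a node sees of its r-hop neighborhood: the induced subgraph, with nodes
   named by their identifiers; [view_node i] is [Some (a, m)] if the
   neighborhood has a node with identifier i and input a, where m is [None]
   before that node is processed, and its output and memory afterwards. *)
Record view (I O M : Type) := View {
  view_node : nat -> option (I * option (O * M));
  view_edge : rel nat }.

(* A processed node computes its output and the memory it leaves behind from n,
   its own identifier and its view. *)
Record slocal_algorithm (I O : Type) := SlocalAlgorithm {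
  smem : Type;
  sproc : nat -> nat -> view I O smem -> O * smem }.

Section SlocalRun.
Variables (I O : Type) (A : slocal_algorithm I O).
Variables (G : sgraph) (id : G -> nat) (x : G -> I) (r : nat).

Definition slocal_view (st : G -> option (O * smem A)) (v : G) :
    view I O (smem A) :=
  let B := hop_ball r v in
  {| view_node i := omap (fun u => (x u, st u)) [pick u in B | id u == i];
     view_edge i j := [exists u in B, exists w in B,
                         [&& id u == i, id w == j & adj u w]] |}.

Definition slocal_process (st : G -> option (O * smem A)) (v : G) :
    G -> option (O * smem A) :=
  fun u => if u == v then Some (sproc #|G| (id v) (slocal_view st v))
           else st u.

Definition slocal_run (order : seq G) : G -> option (O * smem A) :=
  foldl slocal_process (fun=> None) order.
End SlocalRun.

Definition SLOCAL (k : nat) (t : nat -> nat) (P : problem) : Prop :=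
  exists A : slocal_algorithm (input P) (output P),
  forall (G : sgraph) (x : G -> input P) (id : G -> nat) (order : seq G),
    admissible x -> identifiers k id -> perm_eq order (enum G) ->
    exists y : G -> output P,
      (forall v, omap fst (slocal_run A id x (t #|G|) order v) = Some (y v)) /\
      valid x y.

(* The exponent k of the identifier space is an arbitrary constant, on which
   the algorithm and its polylogarithmic complexity may depend. *)
Definition P_LOCAL (P : problem) : Prop :=
  forall k, exists2 t, polylog t & LOCAL k t P.

Definition P_SLOCAL (P : problem) : Prop :=
  forall k, exists2 t, polylog t & SLOCAL k t P.

Definition polylog_reducible (P1 P2 : problem) : Prop :=
  P_LOCAL P2 -> P_LOCAL P1.

Definition P_SLOCAL_complete (P : problem) : Prop :=
  P_SLOCAL P /\ forall Q, P_SLOCAL Q -> polylog_reducible Q P.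

Local Open Scope ring_scope.

(* The local input is the side of the node: true for U, false for V. *)
Definition bipartite (G : sgraph) (side : G -> bool) : Prop :=
  forall u v : G, adj u v -> side u != side v.

(* Colors are booleans (say, true is red and false is blue); colors given to
   nodes of U are ignored. *)
Definition is_local_splitting (R : realType) (lam : R) (G : sgraph)
    (side : G -> bool) (color : G -> bool) : Prop :=
  forall u : G, side u -> forall b : bool,
    Num.floor (lam * (deg u)%:R) <= #|[set v | adj u v & color v == b]|%:Z.

(* Here lam is a function of the number of nodes. *)
Definition local_splitting (R : realType) (c : R) (lam : nat -> R) : problem :=
  {| input := bool;
     output := bool;
     admissible G side := bipartite side /\
       forall u : G, side u -> c * ln (#|G|%:R) ^+ 2 <= (deg u)%:R;
     valid G side color := is_local_splitting (lam #|G|) side color |}.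

(* 1 / lam(n) = log^{O(1)} n, written as a lower bound on lam; the exponent
   absorbs the base of the logarithm and its rounding. *)
Definition inverse_polylog (R : realType) (lam : nat -> R) : Prop :=
  exists C N : nat, forall n : nat, (N <= n)%N ->
    ((trunc_log 2 n)%:R ^+ C)^-1 <= lam n.

(* Main.v *)
Require Import Defs.
From HB Require Import structures.
From mathcomp Require Import all_boot all_order all_algebra.
From mathcomp Require Import boolp reals sequences exp.
From mathcomp Require Import zify ring lra.

Set Implicit Arguments.
Unset Strict Implicit.
Unset Printing Implicit Defensive.

Import Order.TTheory GRing.Theory Num.Theory.

(* Membership: color V at random. For u in U of degree d, a Chernoff bound with
   base z = 1/(1+eps) makes both colors frequent except with probability
   exp(-d eps^2/2), so a union bound applies once d >= c ln^2 n. The method of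
   conditional expectations derandomizes this: the pessimistic estimator of u
   only depends on the neighbors of u, so a node v which minimizes the sum of
   the estimators of its neighbors only looks at distance 2.

   Hardness: every problem Q of P-SLOCAL is in fact in P-LOCAL, whatever it is to
   be reduced to. By the algorithm of Rozhon and Ghaffari, the r-th power of the graph has a network decomposition with
   O(log n) colors and clusters of polylogarithmic weak diameter, computable in
   polylogarithmically many rounds. Run the SLOCAL algorithm for Q, of locality
   r, in the order given by (color, identifier): since clusters of the same
   color are more than r apart, the output of a node only depends on its
   polylogarithmic neighborhood.

   In the LOCAL model, it suffices to show that outputs are invariant under
   isomorphism of t-hop neighborhoods: nodes can collect all the information,
   and local computation is free. *)

(** * Locality *)

Section HopBall.
Variable G : sgraph.
Implicit Types u v w : G.

Lemma hop_ballS r v w :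
  (w \in hop_ball r.+1 v) =
  (w \in hop_ball r v) || [exists u in hop_ball r v, adj u w].
Proof. by rewrite /hop_ball iterS !inE. Qed.

Lemma mem_hop_ball0 v w : (w \in hop_ball 0 v) = (w == v).
Proof. by rewrite !inE. Qed.

Lemma hop_ball_leq r s v w :
  r <= s -> w \in hop_ball r v -> w \in hop_ball s v.
Proof.
move=> /subnK <-; elim: (s - r) => // m IH /IH.
by rewrite addSn hop_ballS => ->.
Qed.

Lemma hop_ball_refl r v : v \in hop_ball r v.
Proof. by apply: (@hop_ball_leq 0) => //; rewrite mem_hop_ball0. Qed.

Lemma hop_ball_trans r s u v w :
  u \in hop_ball r v -> w \in hop_ball s u -> w \in hop_ball (r + s) v.
Proof.
move=> uv; elim: s w => [|s IH] w.
  by rewrite mem_hop_ball0 addn0 => /eqP ->.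
rewrite addnS !hop_ballS => /orP[/IH -> //|/existsP[y /andP[/IH y_in yw]]].
by apply/orP; right; apply/existsP; exists y; rewrite y_in.
Qed.

Lemma adj_hop_ball u v : adj u v -> v \in hop_ball 1 u.
Proof.
move=> uv; rewrite hop_ballS; apply/orP; right.
by apply/existsP; exists u; rewrite hop_ball_refl.
Qed.

Lemma hop_ball_sym r u v : (u \in hop_ball r v) = (v \in hop_ball r u).
Proof.
suff sub w y : w \in hop_ball r y -> y \in hop_ball r w.
  by apply/idP/idP; exact: sub.
elim: r w => [|r IH] w; first by rewrite !mem_hop_ball0 eq_sym.
rewrite hop_ballS => /orP[/IH|/existsP[z /andP[/IH zy zw]]].
  by apply: hop_ball_leq.
by rewrite -add1n; apply: hop_ball_trans zy; apply: adj_hop_ball; rewrite adj_sym.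
Qed.

End HopBall.

(** * Indistinguishable neighborhoods and local output functions *)

Record instance (I : Type) := Instance {
  graph :> sgraph;
  ident : graph -> nat;
  inp : graph -> I }.

Section Agreement.
Variables (I : Type) (n k : nat).
Implicit Types g h : instance I.

Definition wf g := #|g| = n /\ identifiers k (@ident _ g).

Lemma wf_inj g : wf g -> injective (@ident _ g).
Proof. by case=> _ []. Qed.

(* Bisimilarity up to depth T. As identifiers are unique, this amounts to
   equality of the T-hop neighborhoods, and it is what T rounds can detect. *)
Fixpoint agree g h (T : nat) (v : g) (w : h) : Prop :=
  if T is T'.+1 then
    [/\ agree T' v w,
        forall u, adj v u -> exists2 u', adj w u' & agree T' u u' &
        forall u', adj w u' -> exists2 u, adj v u & agree T' u u']
  else ident v = ident w /\ inp v = inp w.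

Lemma agree_sym g h T (v : g) (w : h) : agree T v w -> agree T w v.
Proof.
elim: T v w => [|T IH] v w /=; first by case.
case=> vw vu wu; split; first exact: IH.
  by move=> u /wu[u' ? ?]; exists u' => //; exact: IH.
by move=> u /vu[u' ? ?]; exists u' => //; exact: IH.
Qed.

Lemma agree_leq g h T T' (v : g) (w : h) :
  T <= T' -> agree T' v w -> agree T v w.
Proof. by move=> /subnK <-; elim: (T' - T) => // m IH /= [/IH]. Qed.

Lemma agree_ident g h T (v : g) (w : h) : agree T v w -> ident v = ident w.
Proof. by move=> /(agree_leq (leq0n T))[]. Qed.

Lemma agree_inp g h T (v : g) (w : h) : agree T v w -> inp v = inp w.
Proof. by move=> /(agree_leq (leq0n T))[]. Qed.

Lemma agree_hop_ball g h T j (v : g) (w : h) u :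
  agree (T + j) v w -> u \in hop_ball j v ->
  exists2 u', u' \in hop_ball j w & agree T u u'.
Proof.
elim: j T u => [|j IH] T u vw.
  rewrite mem_hop_ball0 => /eqP ->; exists w; first exact: hop_ball_refl.
  by rewrite addn0 in vw.
rewrite hop_ballS => /orP[u_in|/existsP[y /andP[y_in yu]]].
  have [|u' u'w uu'] := IH T u _ u_in.
    by apply: agree_leq vw; rewrite leq_add2l.
  by exists u' => //; exact: hop_ball_leq u'w.
have [|y' y'w [_ yy' _]] := IH T.+1 y _ y_in.
  by rewrite addSnnS.
have [u' y'u' uu'] := yy' _ yu.
exists u' => //; rewrite hop_ballS; apply/orP; right.
by apply/existsP; exists y'; rewrite y'w.
Qed.

(** One level of agreement at [v] matches the edge with an edge at [w]; uniqueness of identifiers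
    makes its other end [y]. *)
Lemma agree_adj g h (v u : g) (w y : h) T :
  wf h -> agree T.+1 v w -> agree T u y -> adj v u -> adj w y.
Proof.
move=> wfh [_ vw _] uy /vw[y' wy' uy'].
suff -> : y = y' by [].
by apply: (wf_inj wfh); rewrite -(agree_ident uy) (agree_ident uy').
Qed.

Definition local T (O : Type) (f : forall g : instance I, g -> O) :=
  forall g h (v : g) (w : h), wf g -> wf h -> agree T v w -> f g v = f h w.

Lemma local_leq T T' (O : Type) (f : forall g : instance I, g -> O) :
  T <= T' -> local T f -> local T' f.
Proof. by move=> le_T fT g h v w wg wh /(agree_leq le_T); exact: fT. Qed.

Lemma local_exists T j (P : forall g : instance I, g -> bool) :
  local T P ->
  local (T + j) (fun g v => [exists u, (u \in hop_ball j v) && P g u]).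
Proof.
move=> PT; suff imp g h (v : g) (w : h) : wf g -> wf h -> agree (T + j) v w ->
    [exists u, (u \in hop_ball j v) && P g u] ->
    [exists u, (u \in hop_ball j w) && P h u].
  by move=> g h v w wg wh vw; apply/idP/idP; apply: imp => //; exact: agree_sym.
move=> wg wh vw /existsP[u /andP[uv Pu]].
have [u' u'w uu'] := agree_hop_ball vw uv.
by apply/existsP; exists u'; rewrite u'w -(PT _ _ _ _ wg wh uu').
Qed.

Lemma card_ident g h (P : pred g) (Q : pred h) :
  injective (@ident _ g) -> injective (@ident _ h) ->
  (forall v, P v -> exists2 w, ident v = ident w & Q w) ->
  (forall w, Q w -> exists2 v, ident w = ident v & P v) ->
  #|[set v | P v]| = #|[set w | Q w]|.
Proof.
move=> inj_g inj_h PQ QP.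
rewrite !cardE -(size_map (@ident _ g)) -(size_map (@ident _ h)).
apply/perm_size/uniq_perm; rewrite ?map_inj_uniq ?enum_uniq //.
move=> i; apply/mapP/mapP => -[u].
  by rewrite mem_enum inE => /PQ[w -> Qw] ->; exists w => //; rewrite mem_enum inE.
by rewrite mem_enum inE => /QP[w -> Qw] ->; exists w => //; rewrite mem_enum inE.
Qed.

End Agreement.

(** * Full-information algorithms in the LOCAL model *)

Section FullInformation.
Variable I : Type.

Inductive knowledge :=
| Initial of nat & nat & I
| Received of knowledge & (nat -> option knowledge).

Definition full_information (O : Type) (out : knowledge -> O) :
    local_algorithm I O :=
  {| lstate := knowledge; lmsg := knowledge; linit := Initial;
     lsend s _ := s; lstep := Received; lout := out |}.

Variables (O : Type) (out : knowledge -> O).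
Implicit Types g h : instance I.
Let run (g : instance I) := local_run (full_information out) (@ident _ g) (@inp _ g).
Arguments run : clear implicits.

Lemma inbox_ident g T (v u : g) : injective (@ident _ g) -> adj v u ->
  inbox (@ident _ g) (run g T) v (ident u) = Some (run g T u).
Proof.
move=> inj_id vu; rewrite /inbox; case: pickP => [w /andP[_ /eqP/inj_id ->] //|].
by move=> /(_ u); rewrite vu eqxx.
Qed.

Lemma inboxP g T (v : g) i s :
  inbox (@ident _ g) (run g T) v i = Some s ->
  exists2 u, adj v u & run g T u = s.
Proof.
rewrite /inbox; case: pickP => [w /andP[vw _] /= [<-]|//].
by exists w.
Qed.

Fixpoint order_of (s : knowledge) : nat :=
  match s with Initial n _ _ => n | Received s' _ => order_of s' end.

Lemma run_order_of g T (v : g) : order_of (run g T v) = #|g|.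
Proof. by elim: T v => //= T IH v; rewrite -(IH v). Qed.

(** Inboxes are indexed by identifiers, so equal inboxes match the neighbors of [v] and of [w] in
    both directions, with equal states. *)
Lemma run_agree g h T (v : g) (w : h) :
  injective (@ident _ g) -> injective (@ident _ h) ->
  run g T v = run h T w -> agree T v w.
Proof.
move=> inj_g inj_h; elim: T v w => [|T IH] v w /=; first by case=> _ -> ->.
rewrite -/(run g T) -/(run h T) => -[/IH vw eq_inbox]; split=> //.
  move=> u vu; have := inbox_ident T inj_g vu.
  by rewrite eq_inbox => /inboxP[u' wu' /esym/IH ?]; exists u'.
move=> u wu; have := inbox_ident T inj_h wu.
by rewrite -eq_inbox => /inboxP[u' wu' /IH ?]; exists u'.
Qed.

End FullInformation.

(** Each node collects its transcript; [out] chooses classically some run with this transcript and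
    returns the value of [f] there. By [run_agree] and locality the choice does not matter. The
    default [o] is for transcripts that no run produces. *)
Lemma local_realizable (I O : Type) (k : nat) (t : nat -> nat)
    (f : forall g : instance I, g -> O) (o : O) :
  (forall n, local n k (t n) f) ->
  exists A : local_algorithm I O,
  forall g : instance I, identifiers k (@ident _ g) -> forall v : g,
    lout (local_run A (@ident _ g) (@inp _ g) (t #|g|) v) = f g v.
Proof.
move=> f_local.
pose run g := local_run (full_information (fun=> o)) (@ident I g) (@inp _ g).
pose output_of s y := exists (g : instance I) (v : g),
  [/\ identifiers k (@ident _ g), run g (t #|g|) v = s & f g v = y].
pose out s := if pselect (exists y, output_of s y) is left h then projT1 (cid h)
              else o.
exists (full_information out) => g id_g v.
have run_out T : local_run (full_information out) (@ident _ g) (@inp _ g) T = run g T.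
  by elim: T => //= T ->.
rewrite /= run_out /out; case: pselect => [h|[]]; last by exists (f g v), g, v.
case: cid => y /= [g' [v' [id_g' eq_run <-]]].
(* The number of rounds depends on the size, so the sizes are compared first; the transcript records
   them. *)
have eq_card : #|g'| = #|g|.
  by have := run_order_of (fun=> o) (t #|g'|) v'; rewrite -/(run g') eq_run run_order_of.
apply: (f_local #|g|) => //.
rewrite eq_card in eq_run; apply: run_agree eq_run; [exact: id_g'.1|exact: id_g.1].
Qed.

(** * Clustering by the bits of the identifiers *)

Definition bit (i M : nat) : bool := odd (M %/ 2 ^ i).

Lemma modn_expS i L :
  L %% 2 ^ i.+1 = L %% 2 ^ i + bit i L * 2 ^ i.
Proof.
rewrite {1}(divn_eq L (2 ^ i)) -{1}(odd_double_half (L %/ 2 ^ i)) -/(bit i L).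
have lt_mod : L %% 2 ^ i < 2 ^ i by rewrite ltn_mod expn_gt0.
have -> : (bit i L + (L %/ 2 ^ i)./2.*2) * 2 ^ i + L %% 2 ^ i =
          (L %/ 2 ^ i)./2 * 2 ^ i.+1 + (L %% 2 ^ i + bit i L * 2 ^ i).
  by rewrite expnS -muln2; lia.
rewrite modnMDl modn_small // expnS.
by case: (bit i L); lia.
Qed.

(** Bernoulli: the first two terms of the binomial expansion already give [2 * m ^ m]. *)
Lemma expn_succ_ge m : 0 < m -> 2 * m ^ m <= m.+1 ^ m.
Proof.
case: m => // m _; rewrite -[m.+2]addn1 expnDn.
rewrite big_ord_recl big_ord_recl /= !bin0 bin1 /bump /= !exp1n !subn0 !muln1 mul1n.
by rewrite subn1 /= -expnS; lia.
Qed.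

Section Clustering.
Variables (V : finType) (E : rel V) (b : nat).
Implicit Types (l : V -> option nat) (i M L : nat) (v u w : V).
Hypothesis E_sym : symmetric E.

(* One phase of the algorithm of Rozhon and Ghaffari handles bit i of the cluster
   labels: blue nodes (bit 0) propose to an adjacent red cluster, which either
   accepts all its proposals or, if they are too few, kills the proposing nodes
   (label None). *)
Definition members l M := [set w | l w == Some M].
Definition alive l := [set w | l w].
Definition blue i l v := if l v is Some L then ~~ bit i L else false.

Definition proposal i l v : option nat :=
  if blue i l v then
    ohead [seq M <- iota 0 (2 ^ b) |
           bit i M && [exists u, E v u && (l u == Some M)]]
  else None.

(** The threshold 1/(2b) serves twice: an accepting cluster grows by a factor of at least 1 +
    1/(2b), and a phase kills at most a fraction 1/(2b) of the alive nodes. *)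
Definition accepts i l M :=
  #|members l M| <= b.*2 * #|members (proposal i l) M|.

Definition step i l v :=
  if proposal i l v is Some M then if accepts i l M then Some M else None
  else l v.

Definition closed i l M :=
  [forall v, forall u, blue i l v && E v u ==> (l u != Some M)].

Definition bounded l := forall v L, l v = Some L -> L < 2 ^ b.
(** Invariant at phase [i]. It is why proposals test bit [i] only: the lower bits of adjacent labels
    agree already. *)
Definition agree_mod i l := forall u v L M,
  E u v -> l u = Some L -> l v = Some M -> L = M %[mod 2 ^ i].

Lemma closedP i l M :
  reflect (forall v u, blue i l v -> E v u -> l u <> Some M) (closed i l M).
Proof.
apply: (iffP forallP) => [cl v u bv vu|cl v].
  by have /forallP/(_ u) := cl v; rewrite bv vu /= => /eqP.
by apply/forallP => u; apply/implyP => /andP[bv vu]; apply/eqP/(cl v u).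
Qed.

Lemma proposalP i l v M : proposal i l v = Some M ->
  [/\ M < 2 ^ b, bit i M, blue i l v & exists2 u, E v u & l u = Some M].
Proof.
rewrite /proposal; case: ifP => // bv.
set s := [seq _ <- _ | _] => hs.
have : M \in s by case: s hs => //= a s [->]; rewrite mem_head.
rewrite mem_filter mem_iota add0n /=.
move=> /andP[/andP[bM /existsP[u /andP[vu /eqP lu]]] ltM].
by split=> //; exists u.
Qed.

Lemma proposal_None i l v u M : bounded l ->
  proposal i l v = None -> blue i l v -> E v u -> bit i M -> l u <> Some M.
Proof.
move=> bl; rewrite /proposal => + bv vu bM luM; rewrite bv.
set s := [seq _ <- _ | _] => hs.
have : M \in s.
  rewrite mem_filter mem_iota add0n (bl _ _ luM) bM /= andbT.
  by apply/existsP; exists u; rewrite vu luM eqxx.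
by case: s hs.
Qed.

(** Adopted labels have bit [i] set, so a step creates no blue node and a proposing node does not
    stay blue. *)
Lemma blue_step i l v : blue i (step i l) v ->
  [/\ blue i l v, proposal i l v = None & step i l v = l v].
Proof.
rewrite {1}/blue /step; case prop : (proposal i l v) => [M|].
  by case: ifP => // _; have [_ ->] := proposalP prop.
by move=> bv; split=> //; rewrite /blue.
Qed.

Lemma bounded_step i l : bounded l -> bounded (step i l).
Proof.
move=> bl v L; rewrite /step; case prop : (proposal i l v) => [M|].
  by case: ifP => // _ [<-]; case: (proposalP prop).
exact: bl.
Qed.

(** A new label comes from a neighbor, whose low bits agree with those of the old label. *)
Lemma step_mod i l v L : agree_mod i l -> step i l v = Some L ->
  exists2 L', l v = Some L' & L = L' %[mod 2 ^ i].
Proof.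
move=> al; rewrite /step; case prop : (proposal i l v) => [M|]; last by exists L.
case: ifP => // _ [<-]; have [_ _ + [u vu lu]] := proposalP prop.
rewrite /blue; case lv : (l v) => [L'|] // _; exists L' => //.
by apply/esym; apply: al vu lv lu.
Qed.

Lemma agree_mod_step i l : agree_mod i l -> agree_mod i (step i l).
Proof.
move=> al u v L M uv /(step_mod al)[L' lu ->] /(step_mod al)[M' lv ->].
exact: al uv lu lv.
Qed.

Lemma alive_step i l : alive (step i l) \subset alive l.
Proof.
apply/subsetP => v; rewrite !inE /step; case prop : (proposal i l v) => [M|] //.
have [_ _ + _] := proposalP prop.
by rewrite /blue; case: (l v).
Qed.

(** Red nodes never propose, so a red cluster loses no member. *)
Lemma members_step i l M : bit i M ->
  members (step i l) M =
  if accepts i l M then members l M :|: members (proposal i l) M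
  else members l M.
Proof.
move=> bM; apply/setP => v.
case prop : (proposal i l v) => [M'|].
  have [_ bM' + _] := proposalP prop.
  have -> : (v \in members (step i l) M) = (M' == M) && accepts i l M'.
    rewrite inE /step prop; case: ifP => _; last by rewrite andbF.
    by rewrite andbT; apply/eqP/eqP => [[]|->].
  rewrite (fun_if (fun A : {set V} => v \in A)) !inE prop /blue.
  case: (l v) => // L bL.
  have -> : (Some L == Some M) = false by apply: contraNF bL => /eqP[->].
  case: (M' =P M) => [->|neq] /=; first by rewrite eqxx; case: ifP.
  by case: ifP => // _; apply/esym/eqP => -[].
rewrite (fun_if (fun A : {set V} => v \in A)) !inE /step prop orbF.
by case: ifP.
Qed.

Lemma members_proposal_disjoint i l M : bit i M ->
  [disjoint members l M & members (proposal i l) M].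
Proof.
move=> bM; apply/pred0P => v /=; rewrite !inE.
apply/andP => -[/eqP lv /eqP/proposalP[_ _]].
by rewrite /blue lv bM.
Qed.

Lemma card_members_step i l M : bit i M -> accepts i l M ->
  #|members (step i l) M| = #|members l M| + #|members (proposal i l) M|.
Proof.
move=> bM acc; rewrite members_step // acc cardsU.
have := members_proposal_disjoint l bM; rewrite -setI_eq0 => /eqP ->.
by rewrite cards0 subn0.
Qed.

Lemma closed_proposal i l M : closed i l M -> members (proposal i l) M = set0.
Proof.
move=> /closedP cl; apply/setP => v; rewrite !inE.
by apply/eqP => /proposalP[_ _ bv [u vu]]; exact: cl vu.
Qed.

Lemma closed_members_step i l M : bit i M -> closed i l M ->
  members (step i l) M = members l M.
Proof.
by move=> bM cl; rewrite members_step // closed_proposal // setU0; case: ifP.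
Qed.

Lemma closed_step i l M : bit i M -> closed i l M -> closed i (step i l) M.
Proof.
move=> bM cl; apply/closedP => v u /blue_step[bv _ _] vu.
move/eqP; rewrite -/(members _ _).
have -> : (step i l u == Some M) = (u \in members (step i l) M) by rewrite inE.
by rewrite closed_members_step // inE => /eqP; apply/(closedP _ _ _ cl v).
Qed.

(** Every blue node next to a red cluster proposes somewhere, hence turns red or dies, and a
    rejecting cluster gains no member; so no blue node remains next to it. *)
Lemma not_accepts_closed i l M : bounded l -> bit i M -> ~~ accepts i l M ->
  closed i (step i l) M.
Proof.
move=> bl bM acc; apply/closedP => v u /blue_step[bv prop _] vu /eqP.
have -> : (step i l u == Some M) = (u \in members (step i l) M) by rewrite inE.
rewrite members_step // (negPf acc) inE => /eqP.
exact: proposal_None bv vu bM.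
Qed.

Lemma sum_members l (P : pred nat) :
  \sum_(M < 2 ^ b | P M) #|members l M| <= #|alive l|.
Proof.
rewrite (eq_bigr (fun M : 'I__ => \sum_v (l v == Some (M : nat)))); last first.
  by move=> M _; rewrite -sum1dep_card big_mkcond; apply: eq_bigr => v _; case: eqP.
rewrite exchange_big -sum1dep_card [X in _ <= X]big_mkcond; apply: leq_sum => v _.
case: (l v) => [L|] /=; last by rewrite big1.
have [ltL|geL] := ltnP L (2 ^ b); last first.
  rewrite big1 // => M _; case: eqP => // -[eqM].
  by move: geL; rewrite eqM leqNgt ltn_ord.
apply: leq_trans (_ : \sum_(M < 2 ^ b) (Some L == Some (M : nat)) <= _).
  by rewrite big_mkcond; apply: leq_sum => M _; case: ifP.
rewrite (bigD1 (Ordinal ltL)) //= eqxx big1 // => M neqM.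
by case: eqP => // -[eqL]; case/eqP: neqM; apply: val_inj.
Qed.

Lemma alive_step_killed i l :
  #|alive l| <= #|alive (step i l)| +
    \sum_(M < 2 ^ b | bit i M && ~~ accepts i l M) #|members (proposal i l) M|.
Proof.
rewrite -(cardsID (alive (step i l)) (alive l)) leq_add ?subset_leq_card ?subsetIr //.
apply: leq_trans (_ : #|\bigcup_(M < 2 ^ b | bit i M && ~~ accepts i l M)
                         members (proposal i l) M| <= _).
  apply/subset_leq_card/subsetP => v; rewrite !inE /step => /andP[dead lv].
  case prop : (proposal i l v) dead => [M|]; last by rewrite lv.
  case: ifP => // acc _; have [ltM bM _ _] := proposalP prop.
  apply/bigcupP; exists (Ordinal ltM); first by rewrite bM /= acc.
  by rewrite inE prop.
elim/big_ind2: _ => [|A m B k Am Bk|//]; first by rewrite cards0.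
by apply: leq_trans (leq_add Am Bk); rewrite cardsU leq_subr.
Qed.

(** A potential that pays for killed nodes: it gains at least [b.*2] for each, and never exceeds the
    number of alive nodes. *)
Definition closed_size i l :=
  \sum_(M < 2 ^ b | bit i M && closed i l M) #|members l M|.

(* A cluster rejects a nonempty set of proposals at most once: afterwards it
   is closed. So the nodes it kills can be charged to its members. *)
Lemma closed_size_step i l : bounded l ->
  closed_size i l + b.*2 * (\sum_(M < 2 ^ b | bit i M && ~~ accepts i l M)
                              #|members (proposal i l) M|)
  <= closed_size i (step i l).
Proof.
move=> bl; rewrite /closed_size big_distrr /= !big_mkcondr -big_split /=.
apply: leq_sum => M bM; have [cl|] := boolP (closed i l M).
  rewrite closed_step // closed_members_step // closed_proposal // cards0 muln0.
  by rewrite if_same addn0.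
move=> _; have [acc|_] := ifPn; last by rewrite add0n.
rewrite add0n not_accepts_closed // members_step // (negPf acc).
by apply: ltnW; rewrite ltnNge.
Qed.

Section Phase.
Variables (i : nat) (l0 : V -> option nat).
Hypotheses (bl0 : bounded l0) (al0 : agree_mod i l0).

Let lab s := iter s (step i) l0.

Lemma bounded_iter s : bounded (lab s).
Proof. by elim: s => // s IH; exact: bounded_step. Qed.

Lemma agree_mod_iter s : agree_mod i (lab s).
Proof. by elim: s => // s IH; exact: agree_mod_step. Qed.

Lemma alive_iter_sub s : alive (lab s) \subset alive l0.
Proof. by elim: s => // s IH; apply: subset_trans IH; exact: alive_step. Qed.

Lemma alive_iter s :
  b.*2 * #|alive l0| <= b.*2 * #|alive (lab s)| + #|alive (lab s)|.
Proof.
suff : b.*2 * #|alive l0| <= b.*2 * #|alive (lab s)| + closed_size i (lab s).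
  move=> h; apply: leq_trans h _; rewrite leq_add2l.
  exact: (sum_members (lab s) (fun M => bit i M && closed i (lab s) M)).
elim: s => [|s IH]; first exact: leq_addr.
apply: leq_trans IH _; have bs := @bounded_iter s.
have kill := alive_step_killed i (lab s).
apply: leq_trans (leq_add (leqnn _) (closed_size_step i bs)).
rewrite [X in _ <= _ + X]addnC addnA leq_add2r -mulnDr.
by rewrite leq_mul2l kill orbT.
Qed.

Lemma closed_iter s t M : bit i M -> s <= t -> closed i (lab s) M -> closed i (lab t) M.
Proof.
move=> bM /subnK <-; elim: (t - s) => // m IH /IH; exact: closed_step.
Qed.

Lemma accepts_iter s t M : bit i M -> ~~ closed i (lab t) M -> s < t ->
  accepts i (lab s) M.
Proof.
move=> bM ncl st; apply: contraNT ncl => acc.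
by apply: closed_iter st _ => //; apply: not_accepts_closed => //; exact: bounded_iter.
Qed.

(* A red cluster which is still next to blue nodes accepted in every step, and
   so grew each time by a factor 1 + 1/(2b). *)
Lemma members_grow t M : bit i M -> ~~ closed i (lab t) M ->
  forall s, s <= t -> b.*2.+1 ^ s * #|members l0 M| <= b.*2 ^ s * #|members (lab s) M|.
Proof.
move=> bM ncl; elim=> [|s IH] st //.
have acc := accepts_iter bM ncl st.
rewrite /= card_members_step // !expnS -mulnA mulSn.
have {}IH := IH (ltnW st); move: acc; rewrite /accepts => acc.
have := leq_mul (leqnn (b.*2 ^ s)) acc.
have := leq_mul (leqnn b.*2) IH.
rewrite /= -/(lab s); set x := #|members (lab s) M|; set y := #|members (proposal _ _) M|.
set p := b.*2 ^ s; set q := b.*2.+1 ^ s; move=> h1 h2.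
apply: leq_trans (leq_add IH h1) _.
rewrite !mulnDr; nia.
Qed.

(** Proposals go to clusters that have a member, so an empty red cluster stays empty. This gives the
    growth argument a starting size of at least 1. *)
Lemma members_nonempty s M : bit i M -> members (lab s) M != set0 ->
  members l0 M != set0.
Proof.
elim: s => // s IH bM ne; apply: IH => //; apply: contraNN ne => /eqP ms.
rewrite /= members_step // ms set0U; case: ifP => // _.
rewrite -subset0; apply/subsetP => v; rewrite inE => /eqP/proposalP[_ _ _ [u _ lu]].
have : u \in members (lab s) M by rewrite inE lu.
by rewrite ms inE.
Qed.

(** Otherwise the cluster, nonempty at the start, would have grown by (1 + 1/(2b))^t and outnumber
    [V]. *)
Lemma closed_phase t M : b.*2 ^ t * #|V| < b.*2.+1 ^ t -> bit i M ->
  closed i (lab t) M.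
Proof.
move=> large bM; apply: contraLR large => ncl; rewrite -leqNgt.
have /set0Pn[u ul] : members (lab t) M != set0.
  apply: contraNN ncl => /eqP ms; apply/closedP => v u _ _ lu.
  have : u \in members (lab t) M by rewrite inE lu.
  by rewrite ms inE.
have /(members_nonempty bM) : members (lab t) M != set0 by apply/set0Pn; exists u.
rewrite -card_gt0 => pos.
apply: leq_trans (_ : b.*2.+1 ^ t * #|members l0 M| <= _); first by rewrite leq_pmulr.
apply: leq_trans (members_grow bM ncl (leqnn t)) _.
by rewrite leq_mul2l max_card orbT.
Qed.

(** All red clusters are closed by now, so no edge joins a blue node to a red one: bit [i] agrees as
    well. *)
Lemma agree_mod_phase t : b.*2 ^ t * #|V| < b.*2.+1 ^ t ->
  agree_mod i.+1 (lab t).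
Proof.
move=> large u v L M uv lu lv.
have eq_mod := agree_mod_iter uv lu lv.
rewrite !modn_expS eq_mod; congr (_ + _ * _).
have sep w w' K K' : E w w' -> lab t w = Some K -> lab t w' = Some K' ->
    bit i K' -> bit i K.
  move=> ww' lw lw' bK'; apply: contraT => bK.
  have /closedP/(_ w w') := closed_phase large bK'.
  by rewrite /blue lw lw' => /(_ bK ww').
have uM := sep _ _ _ _ uv lu lv; rewrite E_sym in uv.
have vM := sep _ _ _ _ uv lv lu.
by case: (bit i L) (bit i M) uM vM => [] [] // h1 h2; [have := h2 isT|have := h1 isT].
Qed.

End Phase.

Variable t : nat.
Hypothesis b_gt0 : 0 < b.
Hypothesis t_large : b.*2 ^ t * #|V| < b.*2.+1 ^ t.

Fixpoint cluster l i := if i is i'.+1 then iter t (step i') (cluster l i') else l.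

Lemma bounded_cluster l i : bounded l -> bounded (cluster l i).
Proof. by move=> bl; elim: i => //= i IH; apply: bounded_iter. Qed.

Lemma agree_mod_cluster l i : bounded l -> agree_mod i (cluster l i).
Proof.
move=> bl; elim: i => [|i IH]; first by move=> u v L M; rewrite !modn1.
by apply: agree_mod_phase => //; exact: bounded_cluster.
Qed.

Lemma alive_cluster_sub l i : alive (cluster l i) \subset alive l.
Proof.
by elim: i => //= i IH; apply: subset_trans IH; exact: alive_iter_sub.
Qed.

Lemma cluster_separated l u v L M : bounded l -> E u v ->
  cluster l b u = Some L -> cluster l b v = Some M -> L = M.
Proof.
move=> bl uv lu lv; have := agree_mod_cluster bl uv lu lv.
by rewrite !modn_small //; apply: (@bounded_cluster l b) => //; eassumption.
Qed.

(** Each of the [b] phases loses at most a fraction 1/(2b) of the initial nodes, hence half of them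
    in total. *)
Lemma alive_cluster l : bounded l -> #|alive l| <= 2 * #|alive (cluster l b)|.
Proof.
move=> bl.
have mass i : b.*2 * #|alive l| <= b.*2 * #|alive (cluster l i)| + i * #|alive l|.
  elim: i => [|i IH]; first exact: leq_addr.
  apply: leq_trans IH _; rewrite mulSn addnA leq_add2r.
  apply: leq_trans (alive_iter i (@bounded_cluster l i bl) t) _.
  by rewrite leq_add2l; apply/subset_leq_card/(alive_cluster_sub l i.+1).
by have := mass b; rewrite -!muln2; nia.
Qed.

End Clustering.

(** * Network decomposition of the [r]-th power of the graph *)

Section Decomposition.
Variables (I : Type) (r b t : nat).
Implicit Types g h : instance I.

Definition within (G : sgraph) : rel G := fun v u => u \in hop_ball r v.

Lemma within_sym (G : sgraph) : symmetric (@within G).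
Proof. by move=> u v; exact: hop_ball_sym. Qed.

(* Weak radius: the center z may have left the cluster that carries its name. *)
Definition centered d g (l : g -> option nat) :=
  forall v L, l v = Some L -> exists2 z, ident z = L & v \in hop_ball d z.

Lemma centered_leq d d' g (l : g -> option nat) :
  d <= d' -> centered d l -> centered d' l.
Proof.
move=> le_d cl v L /cl[z zL vz]; exists z => //; exact: hop_ball_leq vz.
Qed.

(** A node joins a cluster along one edge of the power graph, that is, along at most [r] edges of
    the graph. *)
Lemma centered_step d g (l : g -> option nat) i :
  centered d l -> centered (d + r) (step (@within g) b i l).
Proof.
move=> cl v L; rewrite /step; case prop: (proposal _ _ _ _ _) => [M|].
  case: ifP => // _ [<-]; have [_ _ _ [u vu /cl[z zM uz]]] := proposalP prop.
  by exists z => //; apply: hop_ball_trans uz _; rewrite hop_ball_sym.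
by move/(centered_leq (leq_addr r d) cl).
Qed.

Lemma centered_iter d g (l : g -> option nat) i s :
  centered d l -> centered (d + s * r) (iter s (step (@within g) b i) l).
Proof.
move=> cl; elim: s => [|s IH] /=; first by rewrite addn0.
by rewrite mulSn [r + _]addnC addnA; exact: centered_step.
Qed.

Lemma centered_cluster g (l : g -> option nat) i :
  centered 0 l -> centered (i * t * r) (cluster (@within g) b t l i).
Proof.
move=> cl; elim: i => //= i IH.
by rewrite mulSn mulnDl addnC; exact: centered_iter.
Qed.

Definition own_label g (S : {set g}) v : option nat :=
  if v \in S then Some (ident v) else None.

Lemma centered_own_label g (S : {set g}) : centered 0 (own_label S).
Proof.
move=> v L; rewrite /own_label; case: ifP => // _ [<-].
by exists v; rewrite // hop_ball_refl.
Qed.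

(** The survivors of the clustering of [remaining g c] form color class [c]; the killed nodes are
    clustered again for the next color. *)
Fixpoint remaining g (c : nat) : {set g} :=
  if c is c'.+1 then
    remaining g c' :\:
      alive (cluster (@within g) b t (own_label (remaining g c')) b)
  else [set: g].

Definition clustering g c := cluster (@within g) b t (own_label (remaining g c)) b.

Variable C : nat.

Definition color g v := find (fun c => v \notin remaining g c.+1) (iota 0 C).
Definition label g v := clustering (color (g := g) v) v.

Lemma color_leq g (v : g) : color v <= C.
Proof. by rewrite -[X in _ <= X](size_iota 0 C) find_size. Qed.

Lemma centered_label g : centered (b * t * r) (@label g).
Proof.
move=> v L; apply: centered_cluster; exact: centered_own_label.
Qed.

Section Correctness.
Variable g : instance I.
Hypothesis ident_lt : forall v : g, ident v < 2 ^ b.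
Hypothesis b_gt0 : 0 < b.
Hypothesis t_large : b.*2 ^ t * #|g| < b.*2.+1 ^ t.
Hypothesis C_large : #|g| < 2 ^ C.

Lemma bounded_own_label (S : {set g}) : bounded b (own_label S).
Proof. by move=> v L; rewrite /own_label; case: ifP => // _ [<-]. Qed.

Lemma alive_own_label (S : {set g}) : alive (own_label S) = S.
Proof. by apply/setP => v; rewrite inE /own_label; case: (v \in S). Qed.

Lemma card_remaining c : 2 ^ c * #|remaining g c| <= #|g|.
Proof.
elim: c => [|c IH]; first by rewrite mul1n max_card.
apply: leq_trans IH; rewrite expnSr -mulnA leq_mul2l expn_eq0 /=.
have := alive_cluster (@within g) b_gt0 t_large (@bounded_own_label (remaining g c)).
have := alive_cluster_sub (@within g) b t (own_label (remaining g c)) b.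
rewrite alive_own_label => sub; rewrite cardsD (setIidPr sub).
by have := subset_leq_card sub; lia.
Qed.

Lemma remaining_C : remaining g C = set0.
Proof.
apply/eqP; rewrite -cards_eq0 -leqn0 -ltnS.
have := leq_ltn_trans (card_remaining C) C_large.
by rewrite -{2}[2 ^ C]muln1 ltn_mul2l => /andP[].
Qed.

Lemma colorP (v : g) :
  [/\ color v < C, v \in remaining g (color v) & v \notin remaining g (color v).+1].
Proof.
have v_notin : v \notin remaining g C by rewrite remaining_C inE.
have C_gt0 : 0 < C by case: (C) v_notin => //; rewrite inE.
have : has (fun c => v \notin remaining g c.+1) (iota 0 C).
  by apply/hasP; exists C.-1; rewrite ?prednK // mem_iota; lia.
move=> hs; have lt_C : color v < C by have := hs; rewrite has_find size_iota.
have := nth_find 0 hs; rewrite -/(color v) nth_iota // add0n; split=> //.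
case eq_c : (color v) => [|c]; first by rewrite inE.
have : c < find (fun c => v \notin remaining g c.+1) (iota 0 C).
  by rewrite -/(color v) eq_c.
rewrite eq_c in lt_C.
by move/(before_find 0); rewrite nth_iota ?(ltnW lt_C) // => /negbFE.
Qed.

Lemma label_Some (v : g) : label v.
Proof.
by have [_ vin] := colorP v; rewrite /= in_setD vin andbT inE negbK.
Qed.

Lemma label_separated (u v : g) :
  u \in hop_ball r v -> color u = color v -> label u = label v.
Proof.
rewrite hop_ball_sym => uv eq_c; have := label_Some u; have := label_Some v.
rewrite /label eq_c; case lu : (clustering _ u) => [L|] //.
case lv : (clustering _ v) => [M|] // _ _; congr Some.
apply: (cluster_separated (@within_sym g) t_large _ uv lu lv).
exact: bounded_own_label.
Qed.

End Correctness.

Section Locality.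
Variables n k : nat.
Local Notation local T f := (local n k T f).
Local Notation wf := (wf n k).

Lemma local_comp T (O O' : Type) (f : forall g, g -> O) (F : O -> O') :
  local T f -> local T (fun g v => F (f g v)).
Proof. by move=> fT g h v w wg wh vw; rewrite (fT _ _ _ _ wg wh vw). Qed.

Lemma local_proposal T i (l : forall g, g -> option nat) :
  local T l -> local (T + r) (fun g => proposal (@within g) b i (l g)).
Proof.
move=> lT g h v w wg wh vw; rewrite /proposal /blue.
rewrite -(lT _ _ _ _ wg wh (agree_leq (leq_addr r T) vw)).
case: (l g v) => // L; case: ifP => // _; congr ohead; apply: eq_filter => M.
congr (_ && _).
apply: (local_exists (P := fun g u => l g u == Some M) _ wg wh vw).
exact: (local_comp (fun y => y == Some M)).
Qed.

(** Counting is global in general, but a set that lies within distance [j] of [v] can be counted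
    from [v]. *)
Lemma card_local T j (P : forall g, pred g) g h (v : g) (w : h) :
  local T P -> wf g -> wf h -> agree (T + j) v w ->
  (forall u, P g u -> u \in hop_ball j v) ->
  (forall u, P h u -> u \in hop_ball j w) ->
  #|[set u | P g u]| = #|[set u | P h u]|.
Proof.
move=> PT wg wh vw Pv Pw; apply: card_ident; try exact: wf_inj (_ : wf _).
- by move=> u Pu; have [u' _ uu'] := agree_hop_ball vw (Pv u Pu);
    exists u'; [exact: agree_ident uu'|rewrite -(PT _ _ _ _ wg wh uu')].
move=> u Pu; have [u' _ uu'] := agree_hop_ball (agree_sym vw) (Pw u Pu).
by exists u'; [exact: agree_ident uu'|rewrite -(PT _ _ _ _ wh wg uu')].
Qed.

(** Only the cluster to which [v] proposes matters. Its members and proposers are within [d + r] of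
    its center, as is [v], hence within [d.*2 + r.*2] of [v]; evaluating a proposal costs another
    [r]. *)
Lemma local_step T d i (l : forall g, g -> option nat) :
  local T l -> (forall g, wf g -> centered d (l g)) ->
  local (T + (d.*2 + 3 * r)) (fun g => step (@within g) b i (l g)).
Proof.
move=> lT cl g h v w wg wh vw; rewrite /step.
have pT := local_proposal i lT.
have vw_p : agree (T + r + (d.*2 + r.*2)) v w.
  by apply: agree_leq vw; rewrite -!muln2; lia.
have eq_p : proposal (@within g) b i (l g) v = proposal (@within h) b i (l h) w.
  by apply: (pT _ _ _ _ wg wh); apply: agree_leq vw_p; exact: leq_addr.
rewrite -eq_p; case prop : (proposal _ _ _ _ v) => [M|]; last first.
  by apply: (lT _ _ _ _ wg wh); apply: agree_leq vw; exact: leq_addr.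
suff -> : accepts (@within g) b i (l g) M = accepts (@within h) b i (l h) M by [].
have near (f : instance I) (y : f) : wf f -> proposal (@within f) b i (l f) y = Some M ->
    exists2 z, ident z = M & y \in hop_ball (d + r) z.
  move=> wff /proposalP[_ _ _ [u yu lu]]; have [z zM uz] := cl f wff u M lu.
  by exists z => //; apply: hop_ball_trans uz _; rewrite hop_ball_sym.
have close (f : instance I) (y u : f) e : wf f ->
    proposal (@within f) b i (l f) y = Some M ->
    e <= d + r -> (exists2 z, ident z = M & u \in hop_ball e z) ->
    u \in hop_ball (d.*2 + r.*2) y.
  move=> wff py le_e [z zM uz]; have [z' z'M yz'] := near f y wff py.
  have eq_z : z' = z by apply: (wf_inj wff); rewrite zM.
  rewrite eq_z hop_ball_sym in yz'.
  by apply: hop_ball_leq (hop_ball_trans yz' uz); rewrite -!muln2; lia.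
rewrite /accepts; congr (_ <= _ * _).
  apply: (card_local (P := fun g u => l g u == Some M) _ wg wh vw_p).
  - by apply: local_comp; apply: local_leq lT; exact: leq_addr.
  - move=> u /eqP lu; apply: (close _ _ _ d wg prop) (cl g wg u M lu); exact: leq_addr.
  - move=> u /eqP lu; apply: (close _ _ _ d wh _ _ (cl h wh u M lu)).
      by rewrite -eq_p.
    exact: leq_addr.
apply: (card_local (P := fun g u => proposal (@within g) b i (l g) u == Some M)
         _ wg wh vw_p).
- by apply: local_comp.
- by move=> u /eqP pu; apply: (close _ _ _ (d + r) wg prop) (near _ _ wg pu).
- move=> u /eqP pu; apply: (close _ _ _ (d + r) wh _ _ (near _ _ wh pu)) => //.
  by rewrite -eq_p.
Qed.

Definition step_radius := (b * t * r).*2 + 3 * r.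
Definition cluster_radius := b * t * step_radius.
Definition decomposition_radius := C * cluster_radius.

Lemma local_cluster T i (l : forall g, g -> option nat) :
  local T l -> (forall g, wf g -> centered 0 (l g)) -> i <= b ->
  local (T + i * t * step_radius) (fun g => cluster (@within g) b t (l g) i).
Proof.
move=> lT cl; elim: i => [|i IH] le_ib; first by rewrite addn0.
suff iter_local s : s <= t -> local (T + (i * t + s) * step_radius)
    (fun g => iter s (step (@within g) b i) (cluster (@within g) b t (l g) i)).
  by rewrite mulSnr; exact: iter_local.
elim: s => [|s IHs] lt_st; first by rewrite addn0; apply: IH; exact: ltnW.
rewrite addnS mulSn [_ + _ * _]addnC addnA.
apply: (local_step i (l := fun g => iter s _ (cluster _ _ _ (l g) i)) (IHs (ltnW lt_st))).
(* The current weak radius [(i * t + s) * r] is at most [b * t * r], the worst case in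
   [step_radius], as [i < b] and [s < t]. *)
move=> g wg; apply: centered_leq _ (centered_iter (centered_cluster (cl g wg))).
by rewrite -mulnDl leq_mul2r; apply/orP; right; nia.
Qed.

Lemma local_remaining c : local (c * cluster_radius) (fun g v => v \in remaining g c).
Proof.
elim: c => [|c IH]; first by move=> g h v w _ _ _; rewrite !inE.
move=> g h v w wg wh vw; rewrite /= !in_setD.
congr (~~ _ && _); last first.
  by apply: (IH _ _ _ _ wg wh); apply: agree_leq vw; rewrite mulSn leq_addl.
rewrite !inE.
suff clus : local (c * cluster_radius + b * t * step_radius)
    (fun g => cluster (@within g) b t (own_label (remaining g c)) b).
  by congr (isSome _); apply: (clus _ _ _ _ wg wh); rewrite addnC -mulSn.
apply: local_cluster => [||//]; last by move=> *; exact: centered_own_label.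
move=> g' h' v' w' wg' wh' vw'; rewrite /own_label (IH _ _ _ _ wg' wh' vw').
by rewrite (agree_ident vw').
Qed.

Lemma local_color : local decomposition_radius color.
Proof.
move=> g h v w wg wh vw; apply: eq_in_find => c; rewrite mem_iota add0n => lt_c.
congr (~~ _); apply: (local_remaining wg wh); apply: agree_leq vw.
by rewrite leq_mul2r (lt_c : c < C) orbT.
Qed.

End Locality.
End Decomposition.

(** * Simulating SLOCAL algorithms *)

Section SlocalRunTheory.
Variables (I O : Type) (A : slocal_algorithm I O).
Variables (G : sgraph) (id : G -> nat) (x : G -> I) (r : nat).
Local Notation run := (slocal_run A id x r).

Lemma slocal_run_rcons s w : run (rcons s w) = slocal_process id x r (run s) w.
Proof. by rewrite /slocal_run foldl_rcons. Qed.

Lemma slocal_run_notin s v : v \notin s -> run s v = None.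
Proof.
elim/last_ind: s => // s w IH; rewrite mem_rcons inE negb_or => /andP[vw vs].
by rewrite slocal_run_rcons /slocal_process (negPf vw) IH.
Qed.

(** Turns the fold into a recursion: a state is written once, so what [v] reads from an earlier node
    is its final state. *)
Lemma slocal_runE s v : uniq s -> v \in s ->
  run s v = Some (@sproc _ _ A #|G| (id v)
    (slocal_view id x r (fun u => if index u s < index v s then run s u else None) v)).
Proof.
elim/last_ind: s => // s w IH; rewrite rcons_uniq mem_rcons inE => /andP[ws us].
rewrite slocal_run_rcons /slocal_process; case: eqP => [-> _|/eqP vw /= vs].
  congr (Some (sproc _ _ (slocal_view _ _ _ _ _))); apply: funext => u.
  rewrite -!cats1 !index_cat (negPf ws) /= eqxx addn0.
  have [us'|us'] := boolP (u \in s); last by rewrite slocal_run_notin // ltnNge leq_addr.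
  by rewrite index_mem us'; case: (u =P w) => // eq_uw; rewrite -eq_uw us' in ws.
rewrite IH //; congr (Some (sproc _ _ (slocal_view _ _ _ _ _))); apply: funext => u.
rewrite -!cats1 !index_cat vs; have [us'|us'] := boolP (u \in s).
  by case: (u =P w) => // eq_uw; rewrite -eq_uw us' in ws.
have le_v : index v s <= size s by exact: index_size.
by rewrite (memNindex us') !ltnNge le_v (leq_trans le_v) // leq_addr.
Qed.

End SlocalRunTheory.

(** * Locality of the run ordered by color and identifier *)

Section Simulation.
Variables (I O : Type) (A : slocal_algorithm I O) (r b t C n k : nat).
Implicit Types g h : instance I.
Hypothesis b_gt0 : 0 < b.
Hypothesis ident_space : n ^ k <= 2 ^ b.
Hypothesis t_large : b.*2 ^ t * n < b.*2.+1 ^ t.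
Hypothesis C_large : n < 2 ^ C.
Local Notation local T f := (local n k T f).
Local Notation wf := (wf n k).
Local Notation color := (color r b t C).
Local Notation label := (label r b t C).

Lemma ident_lt g (v : g) : wf g -> ident v < 2 ^ b.
Proof. by case=> card_g [_ /(_ v)]; rewrite card_g => /leq_trans; apply. Qed.

(** Radius [r] reaches the nodes of the view; one further level carries over the edges between
    them. *)
Lemma slocal_view_agree T g h (v : g) (w : h)
    (st : g -> option (O * smem A)) (st' : h -> option (O * smem A)) :
  wf g -> wf h -> agree (T.+1 + r) v w ->
  (forall u u', u \in hop_ball r v -> agree T.+1 u u' -> st u = st' u') ->
  slocal_view (@ident _ g) (@inp _ g) r st v =
  slocal_view (@ident _ h) (@inp _ h) r st' w.
Proof.
move=> wg wh vw st_eq; rewrite /slocal_view; congr View; apply: funext => i.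
  case: pickP => [u /andP[uv /eqP ui]|none];
    case: pickP => [u' /andP[uw /eqP ui']|none'] //=.
  - have [y _ uy] := agree_hop_ball vw uv.
    have <- : y = u' by apply: (wf_inj wh); rewrite ui' -ui (agree_ident uy).
    by rewrite (st_eq _ _ uv uy) (agree_inp uy).
  - have [y yw uy] := agree_hop_ball vw uv.
    by have := none' y; rewrite yw -(agree_ident uy) ui eqxx.
  - have [y yw uy] := agree_hop_ball (agree_sym vw) uw.
    by have := none y; rewrite yw -(agree_ident uy) ui' eqxx.
apply: funext => j.
have imp (f f' : instance I) (y : f) (y' : f') : wf f' -> agree (T.+1 + r) y y' ->
    [exists u in hop_ball r y, exists u' in hop_ball r y,
       [&& ident u == i, ident u' == j & adj u u']] ->
    [exists u in hop_ball r y', exists u' in hop_ball r y',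
       [&& ident u == i, ident u' == j & adj u u']].
  move=> wf' yy' /existsP[u /andP[uy /existsP[u' /andP[u'y /and3P[ui u'j uu']]]]].
  have [a ay' ua] := agree_hop_ball yy' uy.
  have [a' a'y' u'a'] := agree_hop_ball yy' u'y.
  apply/existsP; exists a; rewrite ay'; apply/existsP; exists a'; rewrite a'y'.
  rewrite -(agree_ident ua) ui -(agree_ident u'a') u'j.
  exact: agree_adj wf' ua (agree_leq (leqnSn T) u'a') uu'.
by apply/idP/idP; apply: imp => //; exact: agree_sym.
Qed.

(** The lexicographic order on (color, identifier) as a single number, since identifiers are below
    [2 ^ b]. *)
Definition key g (v : g) := color v * 2 ^ b + ident v.
Definition key_order g : seq g := sort (relpre (@key g) leq) (enum g).
Definition simulation g := slocal_run A (@ident _ g) (@inp _ g) r (key_order g).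

Lemma perm_key_order g : perm_eq (key_order g) (enum g).
Proof. by rewrite perm_sort. Qed.

Lemma mem_key_order g (v : g) : v \in key_order g.
Proof. by rewrite (perm_mem (perm_key_order g)) mem_enum. Qed.

Lemma key_inj g : wf g -> injective (@key g).
Proof.
move=> wg u v /(congr1 (modn^~ (2 ^ b))).
by rewrite /key !modnMDl !modn_small ?ident_lt // => /(wf_inj wg).
Qed.

Lemma index_key_order g (u v : g) : wf g ->
  (index u (key_order g) < index v (key_order g)) = (key u < key v).
Proof.
move=> wg.
have tr : transitive (relpre (@key g) leq) by move=> ? ? ?; exact: leq_trans.
have so : sorted (relpre (@key g) leq) (key_order g).
  by apply: sort_sorted => ? ?; exact: leq_total.
have lt_le w y : index w (key_order g) < index y (key_order g) -> key w <= key y.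
  by move=> wy; apply: (sorted_ltn_index tr so) wy; exact: mem_key_order.
apply/idP/idP => [lt_uv|]; last first.
  rewrite ltnNge [in X in _ -> X]ltnNge; apply: contraNN; rewrite leq_eqVlt.
  case/orP=> [/eqP eq_i|/lt_le //]; suff -> : v = u by [].
  by apply: (index_inj v) eq_i; exact: mem_key_order.
rewrite ltn_neqAle lt_le // andbT; apply: contraTneq lt_uv => /(key_inj wg) ->.
by rewrite ltnn.
Qed.

Definition center_radius := b * t * r.
(** Measured from a cluster center: [center_radius] leads to any node of the cluster, [r + 1] covers
    its view, [decomposition_radius] determines colors there. Each drop of the color costs the way
    to another center and back out. *)
Definition simulation_radius c :=
  decomposition_radius r b t C + center_radius + r + 1 + c * (center_radius.*2 + r).

Lemma label_centered g (v : g) : wf g ->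
  exists2 z, label v = Some (ident z) & v \in hop_ball center_radius z.
Proof.
move=> wg; have [card_g _] := wg.
have : label v.
  by apply: label_Some => //; rewrite ?card_g // => u; exact: ident_lt.
case lv : (label v) => [L|] // _.
by have [z <- vz] := centered_label lv; exists z.
Qed.

(* Following the dependencies of v inside one color class never leaves the
   cluster of v, so the agreement radius is measured from its center z and
   is consumed only when the color decreases. *)
Lemma simulation_cluster m g h (v : g) (w : h) (z : g) (z' : h) :
  wf g -> wf h -> key v < m -> agree (simulation_radius (color v)) z z' ->
  label v = Some (ident z) -> ident v = ident w ->
  simulation v = simulation w.
Proof.
move=> wg wh; elim: m v w z z' => // m IH v w z z' lt_m zz' lv vw.
set D := center_radius in zz'; set T := decomposition_radius r b t C.
have vz : v \in hop_ball D z.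
  by have [y lv' vy] := label_centered v wg; move: lv'; rewrite lv => -[/(wf_inj wg) ->].
pose c := color v.
have {}vw : agree ((T + c * (D.*2 + r)).+1 + r) v w.
  have zz'D : agree ((T + c * (D.*2 + r)).+1 + r + D) z z'.
    by apply: agree_leq zz'; rewrite /simulation_radius -/c; lia.
  have [y _ vy] := agree_hop_ball zz'D vz.
  by have <- : y = w by apply: (wf_inj wh); rewrite -vw (agree_ident vy).
have consistent (u : g) (u' : h) : agree (T + c * (D.*2 + r)).+1 u u' ->
    color u = color u' /\ key u = key u'.
  move=> uu'; have cu : color u = color u'.
    by apply: local_color wg wh _; apply: agree_leq uu'; lia.
  by rewrite /key cu (agree_ident uu').
have [_ key_vw] := consistent v w (agree_leq (leq_addr _ _) vw).
rewrite /simulation !slocal_runE ?sort_uniq ?enum_uniq ?mem_key_order //.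
have [card_g _] := wg; have [card_h _] := wh.
rewrite card_g card_h (agree_ident vw); congr (Some (sproc _ _ _)).
apply: (slocal_view_agree wg wh vw) => u u' uv uu'.
rewrite !index_key_order //; have [cu ku] := consistent u u' uu'.
rewrite -ku -key_vw; case: ifP => // lt_uv; rewrite -!/(simulation _).
have lt_um : key u < m by apply: leq_trans lt_uv _.
(* A node of the same color within distance [r] is in the same cluster, so the center stays [z] and
   no radius is spent. *)
have [eq_c|neq_c] := eqVneq (color u) c.
  apply: (IH u u' z z') => //; [by rewrite eq_c| |exact: agree_ident uu'].
  rewrite -lv; apply: label_separated => //; rewrite ?card_g // => x.
  exact: ident_lt.
have lt_c : color u < c.
  rewrite ltn_neqAle neq_c leqNgt /=; apply/negP => lt_cu.
  move: lt_uv; rewrite /key -/c; have := ident_lt v wg; nia.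
(* The color drops: the induction hypothesis is applied at the center [y] of the cluster of [u]. *)
have [y lu uy] := label_centered u wg; rewrite hop_ball_sym in uy.
have uu'D : agree (simulation_radius (color u) + D) u u'.
  apply: agree_leq uu'; rewrite /simulation_radius -/D -/T.
  by nia.
have [y' _ yy'] := agree_hop_ball uu'D uy.
by apply: (IH u u' y y') => //; exact: agree_ident uu'.
Qed.

Lemma local_simulation : local (simulation_radius C + center_radius) simulation.
Proof.
move=> g h v w wg wh vw; have [z lv vz] := label_centered v wg.
rewrite hop_ball_sym in vz; have [z' _ zz'] := agree_hop_ball vw vz.
apply: (@simulation_cluster (key v).+1 _ _ _ _ z z') => //; last exact: agree_ident vw.
by apply: agree_leq zz'; rewrite leq_add2l leq_mul2r color_leq orbT.
Qed.

End Simulation.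

(** * Closure properties of polylogarithmic bounds *)

Section Polylog.
Implicit Types f g : nat -> nat.

Lemma trunc_log_ge2 n : 4 <= n -> 2 <= trunc_log 2 n.
Proof. exact: (@trunc_log_max 2 n 2). Qed.

Lemma polylog_trunc_log : polylog (trunc_log 2).
Proof. by exists 1, 0 => n _; rewrite expn1. Qed.

Lemma polylog_const m : polylog (fun=> m).
Proof.
exists m.+1, 4 => n /trunc_log_ge2 log_ge2.
apply: (@leq_trans (2 ^ m.+1)); first exact: ltnW (ltnW (ltn_expl _ _)).
by rewrite leq_exp2r.
Qed.

Lemma polylogD f g : polylog f -> polylog g -> polylog (fun n => f n + g n).
Proof.
move=> [C [N fC]] [C' [N' gC']]; exists (maxn C C').+1, (maxn 4 (maxn N N')) => n.
rewrite !geq_max => /and3P[/trunc_log_ge2 log_ge2 /fC fn /gC' gn].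
have log_gt0 : 0 < trunc_log 2 n by exact: ltnW.
apply: leq_trans (leq_add fn gn) _.
apply: (@leq_trans (2 * trunc_log 2 n ^ maxn C C')).
  by rewrite mul2n -addnn leq_add // leq_pexp2l ?leq_maxl ?leq_maxr.
by rewrite expnS leq_mul2r log_ge2 orbT.
Qed.

Lemma polylogM f g : polylog f -> polylog g -> polylog (fun n => f n * g n).
Proof.
move=> [C [N fC]] [C' [N' gC']]; exists (C + C'), (maxn N N') => n.
by rewrite geq_max expnD => /andP[/fC fn /gC' gn]; exact: leq_mul.
Qed.

Lemma polylog_double f : polylog f -> polylog (fun n => (f n).*2).
Proof.
move=> pf; have [C [N h]] := polylogD pf pf.
by exists C, N => n /h; rewrite addnn.
Qed.

End Polylog.

(** * Parameters of the decomposition and the round complexity *)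

Section TimeBound.
Variables (k : nat) (t : nat -> nat).

(** The final 1 keeps the number of bits positive even for [k = 0]. *)
Definition id_bits n := k * (trunc_log 2 n).+1 + 1.
Definition colors n := (trunc_log 2 n).+1.
(** With b = [id_bits n], growth by 1 + 1/(2b) doubles a cluster within 2b steps, and [colors n]
    doublings exceed [n]. *)
Definition phase_length n := (id_bits n).*2 * colors n.

Lemma colors_large n : n < 2 ^ colors n.
Proof. exact: trunc_log_ltn. Qed.

Lemma id_bits_large n : n ^ k <= 2 ^ id_bits n.
Proof.
rewrite /id_bits mulnC expnD expnM expn1.
case: k => // k'; apply: leq_trans (leq_pmulr _ _) => //.
by rewrite leq_exp2r // ltnW // colors_large.
Qed.

Lemma phase_length_large n :
  (id_bits n).*2 ^ phase_length n * n < (id_bits n).*2.+1 ^ phase_length n.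
Proof.
have b_gt0 : 0 < (id_bits n).*2 by rewrite double_gt0 /id_bits addn1.
rewrite /phase_length !expnM.
apply: (@leq_trans ((2 * (id_bits n).*2 ^ (id_bits n).*2) ^ colors n)).
  rewrite expnMn mulnC ltn_mul2r colors_large !expn_gt0 b_gt0.
  by [].
by rewrite leq_exp2r // expn_succ_ge.
Qed.

Definition simulation_time n :=
  simulation_radius (t n) (id_bits n) (phase_length n) (colors n) (colors n) +
  center_radius (t n) (id_bits n) (phase_length n).

Lemma polylog_simulation_time : polylog t -> polylog simulation_time.
Proof.
move=> pt; have plog := polylog_trunc_log.
have pcolors : polylog colors.
  have [C [N h]] := polylogD plog (polylog_const 1).
  by exists C, N => n /h; rewrite addn1.
have pbits : polylog id_bits.
  by apply: polylogD (polylog_const 1); apply: polylogM pcolors; exact: polylog_const.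
have pphase : polylog phase_length by apply: polylogM pcolors; exact: polylog_double.
have pcenter : polylog (fun n => center_radius (t n) (id_bits n) (phase_length n)).
  by apply: polylogM pt; exact: polylogM.
have pdec : polylog
    (fun n => decomposition_radius (t n) (id_bits n) (phase_length n) (colors n)).
  apply: polylogM => //.
  apply: polylogM; first exact: polylogM.
  apply: polylogD; first exact: polylog_double.
  by apply: polylogM pt; exact: polylog_const.
apply: polylogD => //; apply: polylogD.
  apply: polylogD (polylog_const 1); apply: polylogD pt; exact: polylogD.
by apply: polylogM => //; apply: polylogD pt; exact: polylog_double.
Qed.

End TimeBound.

Lemma P_SLOCAL_sub_P_LOCAL (Q : problem) : P_SLOCAL Q -> P_LOCAL Q.
Proof.
move=> slocal k; have [t pt [A A_correct]] := slocal k.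
exists (simulation_time k t); first exact: polylog_simulation_time.
pose sim (g : instance (input Q)) := simulation A (t #|g|) (id_bits k #|g|)
  (phase_length k #|g|) (colors #|g|) (g := g).
(* A default output is needed; processing an empty view supplies one. *)
pose o := (@sproc _ _ A 0 0 (View (fun=> None) (fun _ _ => false))).1.
pose f (g : instance (input Q)) (v : g) := odflt o (omap fst (sim g v)).
have f_local n : local n k (simulation_time k t n) f.
  move=> g h v w wg wh vw; rewrite /f /sim.
  have [-> _] := wg; have [-> _] := wh; congr (odflt _ (omap _ _)).
  apply: local_simulation wg wh vw.
  - by rewrite /id_bits addn1.
  - exact: id_bits_large.
  - exact: phase_length_large.
  - exact: colors_large.
have [B B_correct] := local_realizable o f_local.
exists B => G x id adm id_ok; pose g := Instance id x.
(* [A] is correct for every processing order, in particular for [key_order]. *)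
have [y [run_y valid_y]] := A_correct G x id _ adm id_ok
  (perm_key_order (t #|G|) (id_bits k #|G|) (phase_length k #|G|) (colors #|G|) g).
suff -> : (fun v => lout (local_run B id x (simulation_time k t #|G|) v)) = y by [].
apply: funext => v; have /= -> := B_correct g id_ok v.
by rewrite /f /sim /simulation /= run_y.
Qed.

Local Open Scope ring_scope.

(** * Splitting by conditional expectations *)

Section Potential.
Variables (R : realType) (z : R) (omega : nat -> R) (G : sgraph) (side : G -> bool).
Hypothesis omega_ge0 : forall d, 0 <= omega d.
Implicit Types (s : G -> option bool) (u v w : G) (b c : bool).

(* The expectation of z^(number of neighbors of u of color c) when the uncolored
   nodes choose a color uniformly at random. *)
Definition factor c (o : option bool) : R :=
  if o is Some c' then if c' == c then z else 1 else (1 + z) / 2.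

(** For [z < 1] and [omega d] = z^(-m), the term of color [c] bounds the probability that [u] gets
    at most m neighbors of color [c]. *)
Definition potential_at s u : R :=
  \sum_(c : bool) omega (deg u) * \prod_(w | adj u w) factor c (s w).
Definition potential s : R := \sum_(u | side u) potential_at s u.
Definition assign s v b : G -> option bool := fun w => if w == v then Some b else s w.

Lemma potential_at_assign s v b u : ~~ adj u v ->
  potential_at (assign s v b) u = potential_at s u.
Proof.
move=> uv; apply: eq_bigr => c _; congr (_ * _); apply: eq_bigr => w uw.
by rewrite /assign; case: eqP => // eq_wv; rewrite -eq_wv uw in uv.
Qed.

(** Each product is linear in the factor of [v], and (1 + z)/2 is the mean of [z] and 1. *)
Lemma potential_at_average s v u : s v = None ->
  potential_at s u =
  (potential_at (assign s v true) u + potential_at (assign s v false) u) / 2.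
Proof.
move=> sv; have [uv|uv] := boolP (adj u v); last first.
  by rewrite !potential_at_assign //; field.
rewrite /potential_at -big_split /= mulr_suml; apply: eq_bigr => c _.
rewrite -mulrDr -mulrA; congr (_ * _).
have split_prod s' : \prod_(w | adj u w) factor c (s' w) =
    factor c (s' v) * \prod_(w | adj u w && (w != v)) factor c (s' w).
  by rewrite (bigD1 v).
have rest b : \prod_(w | adj u w && (w != v)) factor c (assign s v b w) =
    \prod_(w | adj u w && (w != v)) factor c (s w).
  by apply: eq_bigr => w /andP[_ wv]; rewrite /assign (negPf wv).
rewrite !split_prod !rest /assign eqxx sv /factor.
by case: (c) => /=; field.
Qed.

(** The second sum does not depend on [b], so the two colors can be compared on the neighbors of [v]
    alone. *)
Lemma potential_assign_split s v b :
  potential (assign s v b) =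
  \sum_(u | adj v u && side u) potential_at (assign s v b) u +
  \sum_(u | ~~ adj v u && side u) potential_at s u.
Proof.
rewrite /potential (bigID (adj v)) /=; congr (_ + _).
  by apply: eq_bigl => u; rewrite andbC.
rewrite (eq_bigl (fun u => ~~ adj v u && side u)) => [|u]; last by rewrite andbC.
by apply: eq_bigr => u /andP[uv _]; rewrite potential_at_assign // adj_sym.
Qed.

Lemma potential_assign_le s v b : s v = None ->
  \sum_(u | adj v u && side u) potential_at (assign s v b) u <=
  \sum_(u | adj v u && side u) potential_at (assign s v (~~ b)) u ->
  potential (assign s v b) <= potential s.
Proof.
move=> sv le_b.
have -> : potential s = (potential (assign s v true) + potential (assign s v false)) / 2.
  rewrite /potential -big_split /= mulr_suml; apply: eq_bigr => u _.
  exact: potential_at_average.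
have : potential (assign s v b) <= potential (assign s v (~~ b)).
  by rewrite !(potential_assign_split s v) lerD2r.
by case: b {le_b} => /=; lra.
Qed.

Lemma potential_init : potential (fun=> None) =
  \sum_(u | side u) 2 * (omega (deg u) * ((1 + z) / 2) ^+ deg u).
Proof.
apply: eq_bigr => u _; rewrite /potential_at big_bool /=.
by rewrite prodr_const -cardsE -mulr2n mulr_natl.
Qed.

Hypothesis z_gt0 : 0 < z.

Lemma factor_ge0 c o : 0 <= factor c o.
Proof.
case: o => [c'|] /=; last by rewrite divr_ge0 // addr_ge0 // ltW.
by case: ifP => // _; exact: ltW.
Qed.

Lemma potential_at_ge0 s u : 0 <= potential_at s u.
Proof.
apply: sumr_ge0 => c _; apply: mulr_ge0 => //; apply: prodr_ge0 => w _.
exact: factor_ge0.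
Qed.

(** Once every node is colored, the left side is one of the nonnegative summands of the
    potential. *)
Lemma potential_final (y : G -> bool) u b : side u ->
  omega (deg u) * z ^+ #|[set v | adj u v & y v == b]| <= potential (Some \o y).
Proof.
move=> su; rewrite /potential (bigD1 u) //=.
apply: le_trans (_ : potential_at (Some \o y) u <= _); last first.
  by rewrite lerDl; apply: sumr_ge0 => *; exact: potential_at_ge0.
rewrite /potential_at (bigD1 b) //=.
have -> : \prod_(w | adj u w) factor b (Some (y w)) =
          z ^+ #|[set v | adj u v & y v == b]|.
  rewrite -prodr_const [RHS](eq_bigl (fun v => adj u v && (y v == b))).
    by rewrite big_mkcondr.
  by move=> v; rewrite inE.
rewrite lerDl; apply: sumr_ge0 => c _; apply: mulr_ge0 => //.
by apply: prodr_ge0 => w _; exact: (factor_ge0 c (Some (y w))).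
Qed.

End Potential.

(** * The greedy SLOCAL algorithm of locality 2 *)

Section SplittingAlgorithm.
Variables (R : realType) (z : nat -> R) (omega : nat -> nat -> R) (k : nat).
Implicit Types (V : view bool bool unit) (i j n : nat) (b : bool).

Definition view_neighbors n V i : seq nat :=
  [seq j <- iota 0 (n ^ k) | view_edge V i j].

Definition view_color V i : option bool :=
  obind (fun p => omap fst p.2) (view_node V i).

Definition view_side V i : bool := if view_node V i is Some p then p.1 else false.

Definition view_potential n V i b : R :=
  \sum_(j <- view_neighbors n V i | view_side V j)
    \sum_(c : bool) omega n (size (view_neighbors n V j)) *
      \prod_(l <- view_neighbors n V j)
        factor (z n) c (if l == i then Some b else view_color V l).

Definition greedy n i V : bool * unit :=
  (view_potential n V i true <= view_potential n V i false, tt).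

Definition greedy_algorithm : slocal_algorithm bool bool :=
  {| smem := unit; sproc := greedy |}.

Variables (G : sgraph) (id : G -> nat) (side : G -> bool).
Hypothesis id_ok : identifiers k id.

Let view_at st v := slocal_view (A := greedy_algorithm) id side 2 st v.
Definition colors_of (st : G -> option (bool * unit)) : G -> option bool :=
  fun w => omap fst (st w).

Lemma view_at_node st v u : u \in hop_ball 2 v ->
  view_node (view_at st v) (id u) = Some (side u, st u).
Proof.
move=> uv /=; case: pickP => [w /andP[_ /eqP/id_ok.1 ->] //|/(_ u)].
by rewrite uv eqxx.
Qed.

(** For [u] at distance at most 1, all edges at [u] lie inside the 2-hop view of [v], and
    identifiers below [n ^ k] are all enumerated. *)
Lemma view_at_neighbors st v u : u \in hop_ball 1 v ->
  perm_eq (view_neighbors #|G| (view_at st v) (id u)) [seq id w | w <- enum (adj u)].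
Proof.
move=> uv; apply: uniq_perm.
- by rewrite filter_uniq ?iota_uniq.
- by rewrite map_inj_uniq ?enum_uniq; [|exact: id_ok.1].
move=> j; rewrite mem_filter mem_iota add0n andTb; apply/andP/mapP => [[]|[w]].
  move=> /existsP[a /andP[_ /existsP[w /andP[_ /and3P[/eqP/id_ok.1 -> /eqP <- uw]]]]] _.
  by exists w; rewrite // mem_enum.
rewrite mem_enum => uw ->; have {}uw : adj u w := uw; split; last exact: id_ok.2.
apply/existsP; exists u; rewrite (hop_ball_leq (isT : (1 <= 2)%N) uv).
apply/existsP; exists w; rewrite !eqxx uw !andbT.
exact: (hop_ball_trans uv (adj_hop_ball uw)).
Qed.

Lemma view_potentialE st v b :
  view_potential #|G| (view_at st v) (id v) b =
  \sum_(u | adj v u && side u)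
    potential_at (z #|G|) (omega #|G|) (assign (colors_of st) v b) u.
Proof.
rewrite /view_potential (perm_big _ (view_at_neighbors st (hop_ball_refl 1 v))) big_map.
rewrite big_enum_cond /=; apply: eq_big => u; last move=> /andP[vu _].
  have -> : (u \in adj v) = adj v u by [].
  case vu : (adj v u) => //=; rewrite /view_side view_at_node //.
  exact: (hop_ball_leq (isT : (1 <= 2)%N) (adj_hop_ball vu)).
have nb := view_at_neighbors st (adj_hop_ball vu).
apply: eq_bigr => c _; rewrite (perm_big _ nb) (perm_size nb) big_map big_enum /=.
rewrite size_map -cardE /deg cardsE; congr (_ * _); apply: eq_bigr => w uw.
rewrite /assign (inj_eq id_ok.1); case: eqP => // _.
rewrite /view_color view_at_node //.
exact: hop_ball_trans (adj_hop_ball vu) (adj_hop_ball uw).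
Qed.

Local Notation run := (slocal_run greedy_algorithm id side 2).
Local Notation potential := (potential (z #|G|) (omega #|G|) side).

Lemma greedy_potential s : uniq s ->
  potential (colors_of (run s)) <= potential (fun=> None).
Proof.
elim/last_ind: s => // s v IH; rewrite rcons_uniq => /andP[vs /IH].
apply: le_trans; rewrite slocal_run_rcons.
pose b := view_potential #|G| (view_at (run s) v) (id v) true <=
          view_potential #|G| (view_at (run s) v) (id v) false.
have -> : colors_of (slocal_process id side 2 (run s) v) = assign (colors_of (run s)) v b.
  by apply: funext => w; rewrite /colors_of /slocal_process /assign; case: eqP.
apply: potential_assign_le; first by rewrite /colors_of slocal_run_notin.
rewrite -!view_potentialE; case eq_b : b => //=; apply: ltW.
by move/negbT: eq_b; rewrite -ltNge.
Qed.

End SplittingAlgorithm.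

(** * Chernoff and union bounds *)

Section Numerics.
Variables (R : realType) (eps : R).
Hypothesis eps_gt0 : 0 < eps.
Implicit Types (n d m : nat).

(* With z = 1/(1+eps), both z >= exp(-eps) and
   (1+z)/2 <= exp(-eps/(2(1+eps))) are instances of exp x >= 1 + x. *)
Lemma chernoff m d : m%:R <= (2^-1 - eps) * d%:R ->
  ((1 + eps)^-1 ^+ m)^-1 * ((1 + (1 + eps)^-1) / 2) ^+ d <=
  expR (- (d%:R * eps ^+ 2 / 2)).
Proof.
move=> le_m; have eps1_gt0 : 0 < 1 + eps by rewrite addr_gt0.
have eps1_neq0 : 1 + eps != 0 by exact: lt0r_neq0.
have up : ((1 + eps)^-1 ^+ m)^-1 <= expR (eps * m%:R).
  rewrite exprVn invrK expRM_natr.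
  by apply: lerXn2r; rewrite ?nnegrE ?expR_ge0 ?(ltW eps1_gt0) ?expR_ge1Dx.
have down : ((1 + (1 + eps)^-1) / 2) ^+ d <= expR (- (eps / (2 * (1 + eps))) * d%:R).
  rewrite expRM_natr; apply: lerXn2r; rewrite ?nnegrE ?expR_ge0 //.
    by rewrite divr_ge0 // addr_ge0 // invr_ge0 ltW.
  apply: le_trans (expR_ge1Dx _); rewrite le_eqVlt; apply/orP; left; apply/eqP.
  by field.
apply: le_trans (ler_pM _ _ up down) _.
- by rewrite invr_ge0 exprn_ge0 // invr_ge0 ltW.
- by rewrite exprn_ge0 // divr_ge0 // addr_ge0 // invr_ge0 ltW.
rewrite -expRD ler_expR.
have d_ge0 : 0 <= d%:R :> R by [].
have ratio : eps / 2 - eps ^+ 2 / 2 <= eps / (2 * (1 + eps)).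
  rewrite ler_pdivlMr; last by rewrite mulr_gt0.
  by have := exprn_gt0 3 eps_gt0; lra.
have := ler_wpM2l (ltW eps_gt0) le_m; have := ler_wpM2r d_ge0 ratio.
lra.
Qed.

(** The exponent must beat ln n + ln 2 <= 2 ln n, so d eps^2 > 4 ln n suffices. The hypotheses give
    d eps^2 >= c eps^2 (ln 2)(ln n) >= 5 ln n. *)
Lemma chernoff_union n d m (c : R) : (2 <= n)%N ->
  5 / (ln 2 * eps ^+ 2) <= c -> c * ln n%:R ^+ 2 <= d%:R ->
  m%:R <= (2^-1 - eps) * d%:R ->
  n%:R * (2 * (((1 + eps)^-1 ^+ m)^-1 * ((1 + (1 + eps)^-1) / 2) ^+ d)) < 1.
Proof.
move=> n_ge2 le_c le_d le_m.
have ln2_gt0 : 0 < ln 2 :> R by rewrite ln_gt0 // ltr1n.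
have n_gt0 : 0 < n%:R :> R by rewrite ltr0n; exact: ltnW.
have le_ln : ln 2 <= ln n%:R :> R by rewrite ler_ln ?posrE ?ler_nat.
have eps2_gt0 : 0 < eps ^+ 2 by exact: exprn_gt0.
apply: le_lt_trans (_ : n%:R * (2 * expR (- (d%:R * eps ^+ 2 / 2))) < 1).
  by rewrite ler_pM2l // ler_pM2l // chernoff.
set e := - _; have -> : n%:R * (2 * expR e) = expR (ln n%:R + (ln 2 + e)).
  by rewrite !expRD !lnK ?posrE.
rewrite expR_lt1 /e.
have c_large : 5 <= c * (ln 2 * eps ^+ 2) by rewrite -ler_pdivrMr // mulr_gt0.
have ln_n_gt0 : 0 < ln n%:R :> R by exact: lt_le_trans le_ln.
have c_gt0 : 0 < c.
  by apply: lt_le_trans le_c; rewrite divr_gt0 // mulr_gt0.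
have h1 := ler_wpM2r (ltW ln_n_gt0) c_large.
have h2 : c * eps ^+ 2 * (ln 2 * ln n%:R) <= c * eps ^+ 2 * (ln n%:R * ln n%:R).
  by rewrite ler_pM2l ?mulr_gt0 // ler_pM2r.
have h3 := ler_wpM2r (ltW eps2_gt0) le_d.
lra.
Qed.

End Numerics.

(** * Correctness of the greedy splitting, and completeness *)

Lemma local_splitting_P_SLOCAL (R : realType) (eps c : R) (n0 : nat) (lam : nat -> R) :
  0 < eps -> 5 / (ln 2 * eps ^+ 2) <= c -> n0%:R / ln 2 ^+ 2 <= c ->
  (forall n, 0 <= lam n) ->
  (forall n, (n0 <= n)%N -> lam n <= 2^-1 - eps) ->
  P_SLOCAL (local_splitting c lam).
Proof.
move=> eps_gt0 c_large c_n0 lam_ge0 lam_le k.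
exists (fun=> 2%N); first exact: polylog_const.
pose z : R := (1 + eps)^-1; pose m n d := `|Num.floor (lam n * d%:R)|%N.
pose omega n d : R := (z ^+ m n d)^-1.
exists (greedy_algorithm (fun=> z) omega k) => G side id order [bip large] id_ok order_ok.
have order_uniq : uniq order by rewrite (perm_uniq order_ok) enum_uniq.
set run := slocal_run _ _ _ _ _.
pose y v := odflt true (colors_of run v).
have run_y v : colors_of run v = Some (y v).
  by rewrite /y /colors_of /run slocal_runE // (perm_mem order_ok) mem_enum.
exists y; split=> // u su b.
have z_gt0 : 0 < z by rewrite invr_gt0 addr_gt0.
have z_lt1 : z < 1 by rewrite invf_lt1 ?addr_gt0 // ltrDl.
have deg_lt (v : G) : (deg v < #|G|)%N.
  rewrite /deg -cardsT; apply/proper_card/properP; split; first exact: subsetT.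
  by exists v; rewrite inE // adj_irrefl.
have m_le n d : (m n d)%:R <= lam n * d%:R.
  have fl_ge0 : (0 <= Num.floor (lam n * d%:R))%R by rewrite floor_ge0 mulr_ge0.
  by rewrite pmulrn /m gez0_abs // floor_le.
have floorE : Num.floor (lam #|G| * (deg u)%:R) = (m #|G| (deg u))%:Z.
  by rewrite /m gez0_abs // floor_ge0 mulr_ge0.
(* On a single node the promise is void, as ln 1 = 0, but the degree is 0. *)
have [n1|n2] := leqP #|G| 1.
  have -> : deg u = 0%N by have := deg_lt u; lia.
  by rewrite mulr0 floor0.
(* Below [n0] the promise fails at [u]: it asks for a degree of at least c (ln 2)^2 >= [n0], more
   than the number of nodes. *)
have [n_small|n_large] := ltnP #|G| n0.
  have := large u su; rewrite leNgt => /negP[].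
  have ln2_gt0 : 0 < ln 2 :> R by rewrite ln_gt0 // ltr1n.
  have le_ln : ln 2 <= ln #|G|%:R :> R by rewrite ler_ln ?posrE ?ler_nat ?ltr0n // ltnW.
  have c_gt0 : 0 <= c by apply: le_trans c_n0; rewrite divr_ge0 // exprn_ge0 // ltW.
  apply: lt_le_trans (_ : n0%:R <= _).
    by rewrite ltr_nat; exact: ltn_trans (deg_lt u) _.
  rewrite ler_pdivrMr ?exprn_gt0 // in c_n0; apply: le_trans c_n0 _.
  by rewrite ler_wpM2l // lerXn2r ?nnegrE // ltW // (lt_le_trans ln2_gt0).
rewrite floorE lez_nat leqNgt; apply/negP => few.
have omega_ge0 d : 0 <= omega #|G| d by rewrite invr_ge0 exprn_ge0 // ltW.
have final := potential_final omega_ge0 z_gt0 y b su.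
have := @greedy_potential _ (fun=> z) omega k _ _ side id_ok _ order_uniq.
have -> : colors_of (slocal_run (greedy_algorithm (fun=> z) omega k) id side 2 order) =
          Some \o y by apply: funext => v; exact: run_y.
rewrite potential_init => final_init.
have {final_init}final := le_trans final final_init.
(* Too few neighbors of color [b] make the summand of [u] and [b] at least 1 in the final potential,
   while the initial potential is below 1. *)
suff : 1 < 1 :> R by rewrite ltxx.
apply: le_lt_trans (le_trans _ final) _.
  rewrite /omega mulrC ler_pdivlMr ?exprn_gt0 // mul1r.
  exact: (ler_wiXn2l (ltW z_gt0) (ltW z_lt1) (ltnW few)).
apply: (@lt_le_trans _ _ (\sum_(v | side v) #|G|%:R^-1)).
  (* Strictness needs a nonempty sum, which [u] ensures. *)
  apply: ltr_sum; first by apply/hasP; exists u; rewrite ?mem_index_enum.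
  move=> v sv; rewrite -[X in _ < X]mul1r ltr_pdivlMr ?ltr0n ?(ltnW n2) // mulrC.
  apply: chernoff_union (large v sv) _ => //.
  apply: le_trans (m_le _ _) _; apply: ler_wpM2r => //; exact: lam_le.
rewrite sumr_const -[X in X <= _]mulr_natr ler_pdivrMl ?ltr0n ?(ltnW n2) // mulr1.
by rewrite ler_nat max_card.
Qed.

Theorem theorem1p7 (R : realType) (eps : R) (n0 : nat) :
  0 < eps ->
  exists c0 : R, forall c : R, c0 <= c ->
  forall lam : nat -> R,
    (forall n : nat, 0 <= lam n <= 2^-1) ->
    inverse_polylog lam ->
    (forall n : nat, (n0 <= n)%N -> lam n <= 2^-1 - eps) ->
    P_SLOCAL_complete (local_splitting c lam).
Proof.
move=> eps_gt0; have ln2_gt0 : 0 < ln 2 :> R by rewrite ln_gt0 // ltr1n.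
(* The first summand serves the union bound, the second rules out graphs with fewer than [n0]
   nodes. *)
exists (5 / (ln 2 * eps ^+ 2) + n0%:R / ln 2 ^+ 2) => c c_large lam lam_itv _ lam_le.
split; last by move=> Q Q_slocal _; exact: P_SLOCAL_sub_P_LOCAL.
apply: (local_splitting_P_SLOCAL eps_gt0 _ _ _ lam_le).
- by apply: le_trans c_large; rewrite lerDl divr_ge0 // exprn_ge0 // ltW.
- apply: le_trans c_large.
  by rewrite lerDr ltW // divr_gt0 // mulr_gt0 // exprn_gt0.
- by move=> n; case/andP: (lam_itv n).
Qed.
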